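(* For any tree $T$ and any path $P$, each with at least one edge, there exist positive real numbers $c$ and $C$ such that for all positive integers $n$, $$c\,n^{3/2}\leq \mathrm{ex}(n,T\Box P)\leq C\,n^{3/2}.$$
   Context: For a graph $H$ and positive integer $n$, $\mathrm{ex}(n,H)$ denotes the maximum number of edges in an $n$-vertex graph containing no subgraph isomorphic to $H$. For graphs $G$ and $H$, the Cartesian product $G\Box H$ has vertex set $V(G)\times V(H)$, with $(u,v)$ adjacent to $(u',v')$ if and only if either $u=u'$ and $vv'\in E(H)$, or $uu'\in E(G)$ and $v=v'$.
   Formalization: The lower bound is stated for all n ≥ 2 only, since at n = 1 it fails (a one-vertex graph has no edges, so ex(1, T□P) = 0 < c); the upper bound is for all n ≥ 1 as printed. *)

(* Defs.v *)
From HB Require Import structures.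
From mathcomp Require Import all_boot.

Set Implicit Arguments.
Unset Strict Implicit.
Unset Printing Implicit Defensive.

(* A finite simple graph with vertex set V is its set of edges, each edge being
   a set of exactly two vertices. *)
Record sgraph (V : finType) := SGraph {
  edges : {set {set V}};
  edges_card2 : [forall e in edges, #|e| == 2]
}.

HB.instance Definition _ (V : finType) := [isSub for @edges V].
HB.instance Definition _ (V : finType) := [Finite of sgraph V by <:].

Definition adj (V : finType) (G : sgraph V) : rel V :=
  fun x y => [set x; y] \in edges G.

Definition rel_edges (V : finType) (r : rel V) : {set {set V}} :=
  [set [set p.1; p.2] | p : V * V & (p.1 != p.2) && r p.1 p.2].

Lemma rel_edges_card2 (V : finType) (r : rel V) :
  [forall e in rel_edges r, #|e| == 2].
Proof.
apply/forall_inP => e /imsetP[[x y]]; rewrite inE /= => /andP[nxy _] ->.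
by rewrite cards2 nxy.
Qed.

(* The simple graph induced by a relation: loops are dropped and orientation is
   forgotten. *)
Definition graph_of_rel (V : finType) (r : rel V) : sgraph V :=
  SGraph (rel_edges_card2 r).

Lemma adj_sym (V : finType) (G : sgraph V) : symmetric (adj G).
Proof. by move=> x y; rewrite /adj setUC. Qed.

Lemma adj_irrefl (V : finType) (G : sgraph V) : irreflexive (adj G).
Proof.
move=> x; apply/negP => /(forall_inP (edges_card2 G)).
by rewrite setUid cards1.
Qed.

Lemma adj_graph_of_rel (V : finType) (r : rel V) x y :
  adj (graph_of_rel r) x y = (x != y) && (r x y || r y x).
Proof.
apply/imsetP/idP => [[[a b]]|/andP[nxy /orP[rxy|ryx]]]; last 2 first.
- by exists (x, y); rewrite ?inE /= ?nxy.
- by exists (y, x); rewrite ?inE /= 1?eq_sym ?nxy // setUC.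
rewrite inE /= => /andP[nab rab] E.
have nxy : x != y by have := cards2 x y; rewrite E cards2 nab; case: (x != y).
have := set21 x y; have := set22 x y; rewrite E !inE.
case/orP => /eqP ey; case/orP => /eqP ex; subst; rewrite ?rab ?orbT ?nxy //;
  by rewrite eqxx in nxy.
Qed.

Definition cart_prod (U V : finType) (G : sgraph U) (H : sgraph V) :
    sgraph (U * V)%type :=
  graph_of_rel (fun p q : U * V =>
    (p.1 == q.1) && adj H p.2 q.2 || adj G p.1 q.1 && (p.2 == q.2)).

Lemma adj_cart_prod (U V : finType) (G : sgraph U) (H : sgraph V) p q :
  adj (cart_prod G H) p q =
    (p.1 == q.1) && adj H p.2 q.2 || adj G p.1 q.1 && (p.2 == q.2).
Proof.
rewrite adj_graph_of_rel.
rewrite [q.1 == _]eq_sym [q.2 == _]eq_sym (adj_sym H q.2) (adj_sym G q.1) orbb.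
by have [->|//] := eqVneq p q; rewrite !adj_irrefl andbF.
Qed.

Definition connected_graph (V : finType) (G : sgraph V) : Prop :=
  0 < #|V| /\ forall x y : V, connect (adj G) x y.

(* [ucycle] also accepts [::] and [:: x; y] with x, y adjacent; the cycles of a
   simple graph are those of length at least 3. *)
Definition acyclic_graph (V : finType) (G : sgraph V) : Prop :=
  forall c : seq V, ucycle (adj G) c -> size c < 3.

Definition is_tree (V : finType) (G : sgraph V) : Prop :=
  connected_graph G /\ acyclic_graph G.

Definition isomorphic (U V : finType) (G : sgraph U) (H : sgraph V) : Prop :=
  exists2 f : U -> V, bijective f & forall x y, adj H (f x) (f y) = adj G x y.

Definition path_graph (k : nat) : sgraph 'I_k :=
  graph_of_rel (fun i j : 'I_k => i.+1 == j :> nat).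

Definition is_path (V : finType) (G : sgraph V) : Prop :=
  exists2 k : nat, 0 < k & isomorphic (path_graph k) G.

(* [contains G H]: G has a (not necessarily induced) subgraph isomorphic to H;
   the subgraph is the image of H under the injection f. *)
Definition contains (V U : finType) (G : sgraph V) (H : sgraph U) : bool :=
  [exists f : {ffun U -> V},
    injectiveb f && [forall x, forall y, adj H x y ==> adj G (f x) (f y)]].

Lemma containsP (V U : finType) (G : sgraph V) (H : sgraph U) :
  reflect (exists2 f : U -> V, injective f &
             forall x y, adj H x y -> adj G (f x) (f y))
          (contains G H).
Proof.
apply: (iffP existsP) => [[f /andP[/injectiveP injf homf]]|[f injf homf]].
  by exists f => // x y; move/forallP/(_ x)/forallP/(_ y)/implyP: homf.
exists (finfun f); apply/andP; split.
  by apply/injectiveP => x y; rewrite !ffunE => /injf.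
by apply/forallP => x; apply/forallP => y; rewrite !ffunE; apply/implyP/homf.
Qed.

(* The maximum over an empty family is 0, but this never matters when H has an
   edge: the edgeless graph is then H-free. *)
Definition ex (n : nat) (U : finType) (H : sgraph U) : nat :=
  \max_(G : sgraph 'I_n | ~~ contains G H) #|edges G|.

(* Main.v *)
Require Import Defs.
From mathcomp Require Import all_boot all_order all_algebra all_field.
From mathcomp Require Import reals exp.
From mathcomp Require Import zify ring lra.
Import Order.TTheory GRing.Theory Num.Theory.

Set Implicit Arguments.
Unset Strict Implicit.
Unset Printing Implicit Defensive.

Local Open Scope ring_scope.

(** Lower bound: the product contains a 4-cycle, and the point-line incidence
    graph of the affine plane over a field with [2 ^ k] elements is C4-free.

    Upper bound: pass to a subgraph of minimum degree at least [C * sqrt n].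
    Root the tree and send the vertex [(u, i)] of the product to [X_s u], where
    [s = i + depth u + 1]; the product edges then say that [X_(s+1) u] is a
    common neighbour of [X_s u] and [X_s (parent u)].  Produce the layers
    [X_0, X_1, ...] at random, choosing [X_(s+1) u] among these common
    neighbours with weight [1 / deg], and [X_(s+1) root] uniformly among the
    neighbours of [X_s root].  Along every root-to-vertex path of the tree, the
    law of a layer stays that of a stationary random walk observed at even
    times, whatever the coupling between different branches.  For this law a
    pair [X_s (parent u), X_s u] seldom has few common neighbours, so each
    choice is spread out and can avoid all the vertices used before.  The
    random choices are made deterministic by the method of conditional
    expectations. *)

(** * Lists and averages *)

Lemma uniq_map_inj (A B : eqType) (f : A -> B) (r : seq A) :
  uniq (map f r) -> {in r &, injective f}.
Proof.
elim: r => // x r IH /= /andP[fx ur] y z.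
rewrite !inE => /predU1P[->|yr] /predU1P[->|zr] // E.
- by rewrite E map_f in fx.
- by rewrite -E map_f in fx.
- exact: IH.
Qed.

(** Otherwise all terms [p v * (f v - c)] are nonnegative with sum at most 0, so [p] vanishes
    identically. The strict positivity of [p v] is what later makes a chosen vertex adjacent to its
    prescribed neighbours. *)
Lemma exists_le_mean (R : realFieldType) (W : finType) (p f : W -> R) (c : R) :
  (forall v, 0 <= p v) -> \sum_v p v = 1 -> \sum_v p v * f v <= c -> exists2 v, 0 < p v & f v <= c.
Proof.
move=> p0 p1 pf.
have [/existsP[v /andP[]]|/existsPn no] := boolP [exists v, (0 < p v) && (f v <= c)].
  by exists v.
have term0 v : 0 <= p v * (f v - c).
  have [pv|] := ltrP 0 (p v).
    by have := no v; rewrite pv /= -ltNge => /ltW fv; rewrite mulr_ge0 ?subr_ge0.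
  by move=> pv; have /eqP -> : p v == 0 by [rewrite eq_le pv p0]; rewrite mul0r.
have sum0 : \sum_v p v * (f v - c) = 0.
  apply/eqP; rewrite eq_le sumr_ge0 // andbT.
  under eq_bigr do rewrite mulrBr.
  by rewrite sumrB -mulr_suml p1 mul1r subr_le0.
have pz v : p v = 0.
  have /eqP := psumr_eq0P (fun v _ => term0 v) sum0 (i := v) isT.
  rewrite mulf_eq0 => /orP[/eqP //|/eqP fv]; apply/eqP.
  by have := no v; rewrite -[f v](subrK c) fv add0r lexx andbT -leNgt eq_le p0 andbT.
by move: p1; rewrite big1 // => /esym/eqP; rewrite oner_eq0.
Qed.

(** * The random walk, its two-step kernel and midpoint resampling *)

Section RandomWalk.
Variables (R : realFieldType) (W : finType) (e : rel W).
Hypotheses (sym_e : symmetric e) (deg_e : forall x, exists y, e x y).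

Definition awt (x y : W) : R := (e x y)%:R.
Definition degw (x : W) : R := \sum_y awt x y.
Definition step1 (x y : W) : R := awt x y / degw x.
(* Common neighbours are weighted by their inverse degree, which spares the
   usual reduction to almost regular graphs. *)
Definition codegw (x y : W) : R := \sum_m awt x m * awt m y / degw m.
Definition step2 (x y : W) : R := codegw x y / degw x.
(** The law of the midpoint of a two-step walk conditioned on its ends [x] and [y]. When
    [codegw x y] is 0 it is identically 0, hence only a sub-probability in general. *)
Definition resample (x y m : W) : R := awt x m * awt m y / degw m / codegw x y.

Lemma awtC x y : awt x y = awt y x.
Proof. by rewrite /awt sym_e. Qed.

Lemma awt_ge0 x y : 0 <= awt x y.
Proof. exact: ler0n. Qed.

Lemma awt_le1 x y : awt x y <= 1.
Proof. by rewrite /awt; case: e. Qed.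

Lemma degw_ge0 x : 0 <= degw x.
Proof. by apply: sumr_ge0 => y _; apply: awt_ge0. Qed.

Lemma degw_gt0 x : 0 < degw x.
Proof.
have [y exy] := deg_e x; rewrite /degw (bigD1 y) //= ltr_wpDr ?sumr_ge0 //.
by rewrite /awt exy ltr01.
Qed.

Lemma degw_neq0 x : degw x != 0.
Proof. by rewrite gt_eqF // degw_gt0. Qed.

Lemma codegw_ge0 x y : 0 <= codegw x y.
Proof. by apply: sumr_ge0 => m _; rewrite !mulr_ge0 ?invr_ge0 ?awt_ge0 ?degw_ge0. Qed.

Lemma step1_ge0 x y : 0 <= step1 x y.
Proof. by rewrite mulr_ge0 ?invr_ge0 ?awt_ge0 ?degw_ge0. Qed.

Lemma step2_ge0 x y : 0 <= step2 x y.
Proof. by rewrite mulr_ge0 ?invr_ge0 ?codegw_ge0 ?degw_ge0. Qed.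

Lemma resample_ge0 x y m : 0 <= resample x y m.
Proof. by rewrite !mulr_ge0 ?invr_ge0 ?awt_ge0 ?degw_ge0 ?codegw_ge0. Qed.

Lemma sum_step1 x : \sum_y step1 x y = 1.
Proof. by rewrite -mulr_suml divff // degw_neq0. Qed.

Lemma step2E x y : step2 x y = \sum_m step1 x m * step1 m y.
Proof.
rewrite /step2 mulr_suml; apply: eq_bigr => m _.
by rewrite /step1 mulrAC mulrA -!mulrA; congr (_ * _); rewrite mulrCA.
Qed.

Lemma sum_step2 x : \sum_y step2 x y = 1.
Proof.
under eq_bigr do rewrite step2E.
rewrite exchange_big -[RHS](sum_step1 x); apply: eq_bigr => m _.
by rewrite -mulr_sumr sum_step1 mulr1.
Qed.

Lemma degw_step1 x y : degw x * step1 x y = awt x y.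
Proof. by rewrite mulrCA divff ?degw_neq0 ?mulr1. Qed.

Lemma degw_step2 x y : degw x * step2 x y = codegw x y.
Proof. by rewrite mulrCA divff ?degw_neq0 ?mulr1. Qed.

(** The walk is reversible: [degw x * step1 x y] is the symmetric weight [awt x y], so the degree
    measure is stationary. *)
Lemma sum_degw_step1 y : \sum_x degw x * step1 x y = degw y.
Proof. by apply: eq_bigr => x _; rewrite degw_step1 awtC. Qed.

Lemma sum_degw_step2 y : \sum_x degw x * step2 x y = degw y.
Proof.
under eq_bigr do rewrite step2E mulr_sumr.
rewrite exchange_big -[RHS](sum_degw_step1 y); apply: eq_bigr => m _.
by under eq_bigr do rewrite mulrA; rewrite -mulr_suml sum_degw_step1.
Qed.

(** Bayes' rule: drawing the end and then the midpoint is the same as drawing the midpoint first. If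
    [codegw x y] is 0, so is each of its nonnegative summands, and both sides vanish. *)
Lemma step2_resample x y m : step2 x y * resample x y m = step1 x m * step1 m y.
Proof.
rewrite /step2 /resample /step1; have dx := degw_neq0 x; have dm := degw_neq0 m.
have [z0|nz] := eqVneq (codegw x y) 0; last by field; rewrite dx dm nz.
have a0 : awt x m * awt m y / degw m = 0.
  apply: (psumr_eq0P _ z0) => // i _.
  by rewrite !mulr_ge0 ?invr_ge0 ?awt_ge0 ?degw_ge0.
by rewrite z0 !mul0r; transitivity (awt x m * awt m y / degw m / degw x);
  [rewrite a0 mul0r | field; rewrite dx dm].
Qed.

Lemma sum_resample x y : codegw x y != 0 -> \sum_m resample x y m = 1.
Proof. by move=> nz; rewrite -mulr_suml divff. Qed.

Lemma sum_resample_le1 x y : \sum_m resample x y m <= 1.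
Proof.
have [z|nz] := eqVneq (codegw x y) 0; last by rewrite sum_resample.
by rewrite big1 ?ler01 // => m _; rewrite /resample z invr0 mulr0.
Qed.

(* Expectation of [g] over the next [k] vertices of the two-step random walk
   started at [x]. *)
Fixpoint walkE (k : nat) (x : W) (g : seq W -> R) : R :=
  if k is k'.+1 then \sum_y step2 x y * walkE k' y (fun l => g (y :: l))
  else g [::].

Lemma eq_walkE k x g h : (forall l, size l = k -> g l = h l) ->
  walkE k x g = walkE k x h.
Proof.
elim: k x g h => [|k IH] x g h E /=; first exact: E.
apply: eq_bigr => y _; congr (_ * _); apply: IH => l sl.
by apply: E; rewrite /= sl.
Qed.

Lemma le_walkE k x g h : (forall l, size l = k -> g l <= h l) ->
  walkE k x g <= walkE k x h.
Proof.
elim: k x g h => [|k IH] x g h E /=; first exact: E.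
apply: ler_sum => y _; rewrite ler_wpM2l ?step2_ge0 //; apply: IH => l sl.
by apply: E; rewrite /= sl.
Qed.

Lemma walkE_sum (I : finType) (Q : pred I) k x (c : I -> R) (g : I -> seq W -> R) :
  walkE k x (fun l => \sum_(i | Q i) c i * g i l) =
  \sum_(i | Q i) c i * walkE k x (g i).
Proof.
elim: k x g => [//|k IH] x g /=.
under eq_bigr do rewrite IH mulr_sumr.
rewrite exchange_big; apply: eq_bigr => i _; rewrite mulr_sumr.
by apply: eq_bigr => y _; rewrite mulrCA.
Qed.

Lemma walkE_cst k x c : walkE k x (fun=> c) = c.
Proof.
elim: k x => //= k IH x; under eq_bigr do rewrite IH.
by rewrite -mulr_suml sum_step2 mul1r.
Qed.

Lemma walkE_take k D x g : (k <= D)%N ->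
  walkE D x (fun l => g (take k l)) = walkE k x g.
Proof.
elim: D k x g => [|D IH] [|k] x g //= le_kD.
  under eq_bigr do rewrite walkE_cst.
  by rewrite -mulr_suml sum_step2 mul1r.
apply: eq_bigr => y _; congr (_ * _).
exact: (IH k y (fun l => g (y :: l))).
Qed.

(* Expectation of [g] when every vertex of the chain [l] hanging from [x] is
   replaced by a random common neighbour of itself and its predecessor. *)
Fixpoint sweepE (x : W) (l : seq W) (g : seq W -> R) : R :=
  if l is y :: l' then
    \sum_m resample x y m * sweepE y l' (fun s => g (m :: s))
  else g [::].

Lemma sweepE_ge0 x l g : (forall s, 0 <= g s) -> 0 <= sweepE x l g.
Proof.
elim: l x g => [|y l IH] x g E /=; first exact: E.
by apply: sumr_ge0 => m _; rewrite mulr_ge0 ?resample_ge0 ?IH.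
Qed.

(** Resampling turns the even-time positions of a walk from [x] into its odd-time positions: one
    single step, then two-step moves. Bayes' rule is applied at each link. *)
Lemma walkE_sweepE k x g :
  walkE k.+1 x (fun l => sweepE x l g) =
  \sum_m step1 x m * walkE k m (fun l => g (m :: l)).
Proof.
elim: k x g => [|k IH] x g.
  rewrite /=.
  under eq_bigr do rewrite mulr_sumr.
  rewrite exchange_big; apply: eq_bigr => m _.
  under eq_bigr do rewrite mulrA step2_resample.
  by rewrite -mulr_suml -mulr_sumr sum_step1 mulr1.
transitivity (\sum_y step2 x y * walkE k.+1 y (fun l =>
   \sum_m resample x y m * sweepE y l (fun s => g (m :: s)))) => //.
under eq_bigr do rewrite walkE_sum mulr_sumr.
rewrite exchange_big; apply: eq_bigr => m _.
under eq_bigr do rewrite mulrA step2_resample IH -mulrA mulr_sumr.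
rewrite -mulr_sumr; congr (_ * _); rewrite exchange_big; apply: eq_bigr => y _.
by under eq_bigr do rewrite mulrA; rewrite -mulr_suml step2E.
Qed.

(** * Stationary chains and their invariance *)

(** The starting weight [degw] is left unnormalised, so the total mass is [\sum_x degw x]. *)
Definition chainE (k : nat) (g : seq W -> R) : R :=
  \sum_x degw x * walkE k x (fun l => g (x :: l)).

(** The value 0 at the empty list is a default; chains are never empty. *)
Definition sweep (g : seq W -> R) (l : seq W) : R :=
  if l is x :: l' then \sum_m step1 x m * sweepE x l' (fun s => g (m :: s))
  else 0.

Lemma sweep_ge0 g l : (forall s, 0 <= g s) -> 0 <= sweep g l.
Proof.
case: l => //= x l g0.
by apply: sumr_ge0 => m _; rewrite mulr_ge0 ?step1_ge0 ?sweepE_ge0.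
Qed.

(* The stationarity that drives the upper bound. *)
Lemma chainE_sweep k g : chainE k (sweep g) = chainE k g.
Proof.
rewrite /chainE /sweep.
under eq_bigr do rewrite walkE_sum mulr_sumr.
rewrite exchange_big; apply: eq_bigr => m _.
case: k => [|k].
  rewrite /= -(sum_degw_step1 m) mulr_suml.
  by apply: eq_bigr => x _; rewrite mulrA.
(* By reversibility the first pair may be drawn from [m] instead of [x]; the moves from [m] to [x]
   and from [x] to the next midpoint then merge into one [step2]. *)
under eq_bigr => x _.
  rewrite walkE_sweepE mulrA degw_step1 awtC -degw_step1 -mulrA; over.
rewrite -mulr_sumr; congr (_ * _).
under eq_bigr do rewrite mulr_sumr.
rewrite exchange_big; apply: eq_bigr => y _.
by under eq_bigr do rewrite mulrA; rewrite -mulr_suml step2E.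
Qed.

Lemma chainE_iter_sweep k j g : chainE k (iter j sweep g) = chainE k g.
Proof. by elim: j => //= j IH; rewrite chainE_sweep. Qed.

Lemma le_chainE k g h : (forall l, size l = k.+1 -> g l <= h l) ->
  chainE k g <= chainE k h.
Proof.
move=> E; apply: ler_sum => x _; rewrite ler_wpM2l ?degw_ge0 //.
by apply: le_walkE => l sl; apply: E; rewrite /= sl.
Qed.

Lemma chainE_sum (I : finType) (Q : pred I) k (g : I -> seq W -> R) :
  chainE k (fun l => \sum_(i | Q i) g i l) = \sum_(i | Q i) chainE k (g i).
Proof.
rewrite /chainE exchange_big; apply: eq_bigr => x _; rewrite -mulr_sumr.
congr (_ * _); under [RHS]eq_bigr do rewrite -[walkE _ _ _]mul1r.
rewrite -walkE_sum; apply: eq_walkE => l _.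
by under [RHS]eq_bigr do rewrite mul1r.
Qed.

Lemma chainE_take k D g : (k <= D)%N ->
  chainE D (fun l => g (take k.+1 l)) = chainE k g.
Proof.
move=> le_kD; apply: eq_bigr => x _; congr (_ * _).
exact: (walkE_take x (fun l => g (x :: l)) le_kD).
Qed.

(** Forgetting the first vertex preserves the law because [degw] is invariant under [step2]. *)
Lemma chainE_behead k g : chainE k.+1 (fun l => g (behead l)) = chainE k g.
Proof.
rewrite /chainE /=; under eq_bigr do rewrite mulr_sumr.
rewrite exchange_big; apply: eq_bigr => y _.
by under eq_bigr do rewrite mulrA; rewrite -mulr_suml sum_degw_step2.
Qed.

Lemma chainE_drop k j g : chainE (j + k) (fun l => g (drop j l)) = chainE k g.
Proof.
by elim: j => // j <-; rewrite -(chainE_behead (j + k) (fun l => g (drop j l))).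
Qed.

Lemma chainE_cst k c : chainE k (fun=> c) = (\sum_x degw x) * c.
Proof. by rewrite /chainE mulr_suml; under eq_bigr do rewrite walkE_cst. Qed.

(** * Random layers indexed by a rooted tree *)

Section Layers.
Variables (U : finType) (root : U) (par : U -> U) (s : seq U).
Hypotheses (uniq_s : uniq s) (s_full : forall u, u \in s).

Definition tstep (b : U -> W) (u : U) (m : W) : R :=
  if u == root then step1 (b root) m else resample (b (par u)) (b u) m.

Lemma tstep_ge0 b u m : 0 <= tstep b u m.
Proof. by rewrite /tstep; case: ifP => _; rewrite ?step1_ge0 ?resample_ge0. Qed.

Lemma sum_tstep_le1 b u : \sum_m tstep b u m <= 1.
Proof.
rewrite /tstep; case: (u == root); last exact: sum_resample_le1.
by rewrite sum_step1.
Qed.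

Definition upd (m : U -> W) (u : U) (v : W) : U -> W :=
  fun w => if w == u then v else m w.

(* Expectation of [F] when the entries of [m] at [r] are redrawn independently
   given the previous layer [b]. *)
Fixpoint layerE (r : seq U) (b m : U -> W) (F : (U -> W) -> R) : R :=
  if r is u :: r' then \sum_v tstep b u v * layerE r' b (upd m u v) F else F m.

Lemma layerE_ge0 r b m F : (forall m', 0 <= F m') -> 0 <= layerE r b m F.
Proof.
move=> F0; elim: r m => [|u r IH] m //=.
by apply: sumr_ge0 => v _; rewrite mulr_ge0 ?tstep_ge0.
Qed.

Lemma layerE_sum (I : finType) (Q : pred I) r b m (F : I -> (U -> W) -> R) :
  layerE r b m (fun m' => \sum_(i | Q i) F i m') = \sum_(i | Q i) layerE r b m (F i).
Proof.
elim: r m => [|u r IH] m //=.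
under eq_bigr do rewrite IH mulr_sumr.
by rewrite exchange_big.
Qed.

Fixpoint listE (b : U -> W) (l : seq U) (g : seq W -> R) : R :=
  if l is u :: l' then \sum_v tstep b u v * listE b l' (fun t => g (v :: t))
  else g [::].

Lemma listE_ge0 b l g : (forall t, 0 <= g t) -> 0 <= listE b l g.
Proof.
elim: l g => [|u l IH] g g0 //=.
by apply: sumr_ge0 => v _; rewrite mulr_ge0 ?tstep_ge0 ?IH.
Qed.

(** Entries outside [l] are integrated out. Each has total mass at most 1, possibly 0 when no common
    neighbour exists, so nonnegativity of [g] gives an inequality only. *)
Lemma layerE_le_listE r l b m F g : uniq r -> subseq l r ->
    (forall t, 0 <= g t) ->
    (forall m', (forall w, w \notin r -> m' w = m w) -> F m' <= g (map m' l)) ->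
  layerE r b m F <= listE b l g.
Proof.
elim: r l m g => [|u r IH] l m g /=.
  by move=> _ /eqP -> _ /(_ m) /=; apply.
move=> /andP[ur uniq_r] sub_l g0 le_Fg.
have skip : subseq l r ->
    \sum_v tstep b u v * layerE r b (upd m u v) F <= listE b l g.
  move=> sub_lr; apply: (@le_trans _ _ (\sum_v tstep b u v * listE b l g)).
    apply: ler_sum => v _; rewrite ler_wpM2l ?tstep_ge0 //.
    apply: IH => // m' eq_m'; apply: le_Fg => w.
    by rewrite inE negb_or => /andP[wu wr]; rewrite eq_m' // /upd (negPf wu).
  by rewrite -mulr_suml ler_piMl ?sum_tstep_le1 ?listE_ge0.
case: l sub_l le_Fg skip => [|x l] sub_l le_Fg skip; first exact/skip/sub0seq.
case: eqP sub_l => [xu|_] sub_l; last exact: skip.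
rewrite {x}xu in le_Fg skip *.
apply: ler_sum => v _; rewrite ler_wpM2l ?tstep_ge0 //.
apply: IH => // m' eq_m'.
have <- : m' u = v by rewrite eq_m' // /upd eqxx.
apply: le_Fg => w; rewrite inE negb_or => /andP[wu wr].
by rewrite eq_m' // /upd (negPf wu).
Qed.

Definition parent_of : rel U := fun x y => (y != root) && (par y == x).

Lemma listE_path b a l g : path parent_of a l ->
  listE b l g = sweepE (b a) (map b l) g.
Proof.
elim: l a g => [|u l IH] a g //= /andP[/andP[/negPf u_root /eqP pu] pl].
by apply: eq_bigr => v _; rewrite /tstep u_root pu (IH u).
Qed.

Lemma listE_root b l g : path parent_of root l ->
  listE b (root :: l) g = sweep g (map b (root :: l)).
Proof.
move=> pl /=; apply: eq_bigr => v _.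
by rewrite /tstep eqxx (listE_path _ _ pl).
Qed.

Fixpoint layers (j : nat) (F : (U -> W) -> R) (b : U -> W) : R :=
  if j is j'.+1 then layerE s b b (layers j' F) else F b.

Lemma layers_ge0 j F b : (forall m, 0 <= F m) -> 0 <= layers j F b.
Proof. by move=> F0; elim: j b => //= j IH b; apply: layerE_ge0. Qed.

Lemma iter_sweep_ge0 j g l : (forall t, 0 <= g t) -> 0 <= iter j sweep g l.
Proof. by move=> g0; elim: j l => //= j IH l; apply: sweep_ge0. Qed.

(** Restricted to a path from the root, drawing a layer is exactly one [sweep], since each parent is
    the preceding entry. The other branches are discarded by [layerE_le_listE]. *)
Lemma layers_le j l b F g : path parent_of root l -> subseq (root :: l) s ->
    (forall t, 0 <= g t) -> (forall m, F m <= g (map m (root :: l))) ->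
  layers j F b <= iter j sweep g (map b (root :: l)).
Proof.
move=> pl sub_l g0 le_Fg; elim: j b => [|j IH] b; first exact: le_Fg.
rewrite [layers _ _ _]/= iterS -listE_root //.
by apply: layerE_le_listE => // t; apply: iter_sweep_ge0.
Qed.

(** * Derandomisation by conditional expectations *)

Variable z0 : R.

Definition bad (u : U) (b : U -> W) : R := (codegw (b (par u)) (b u) < z0)%R%:R.

(* The expected number of bad pairs met while drawing [j] more layers from [b];
   being below 1, it certifies that no such pair occurs along a good choice. *)
Definition potential (j : nat) (b : U -> W) : R :=
  \sum_(i < j) \sum_(u | u != root) layers i (bad u) b.

Lemma bad_ge0 u b : 0 <= bad u b.
Proof. exact: ler0n. Qed.

Lemma potential_ge0 j b : 0 <= potential j b.
Proof.
by apply: sumr_ge0 => i _; apply: sumr_ge0 => u _; apply/layers_ge0/bad_ge0.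
Qed.

Lemma potentialS j b : potential j.+1 b =
  \sum_(u | u != root) bad u b + layerE s b b (potential j).
Proof.
rewrite /potential big_ord_recl /=; congr (_ + _).
by rewrite layerE_sum; apply: eq_bigr => i _; rewrite layerE_sum.
Qed.

(** Entries are fixed one by one. A new entry hits [used] with probability at most [N * kap], and
    this is added to the expectation of [F] before averaging. A hit would contribute 1, but the
    running total stays below 1, so no hit occurs. *)
Lemma layerE_greedy r b m F (used : seq W) (kap : R) N :
    uniq r -> 0 <= kap -> (forall u v, u \in r -> tstep b u v <= kap) ->
    (forall u, u \in r -> \sum_v tstep b u v = 1) -> (forall m', 0 <= F m') ->
    (size used + size r <= N)%N -> uniq used ->
    layerE r b m F + (size r * N)%:R * kap < 1 ->
  exists m', [/\ forall w, w \notin r -> m' w = m w,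
    forall u, u \in r -> 0 < tstep b u (m' u), uniq (map m' r ++ used) &
    F m' <= layerE r b m F + (size r * N)%:R * kap].
Proof.
move=> + kap0 + + F0.
elim: r m used => [|u r IH] m used /=.
  by move=> _ _ _ _ uniq_used _; exists m; split=> //; rewrite mul0n mul0r addr0.
move=> /andP[ur uniq_r] le_kap sum1 le_N uniq_used lt1.
set S := \sum_v _ in lt1 *.
have [v tv le_v] : exists2 v, 0 < tstep b u v &
    layerE r b (upd m u v) F + (v \in used)%:R <= S + N%:R * kap.
  apply: exists_le_mean; [exact: tstep_ge0|by apply: sum1; rewrite inE eqxx|].
  under eq_bigr do rewrite mulrDr.
  rewrite big_split /= lerD2l.
  apply: (@le_trans _ _ (\sum_v kap * (v \in used)%:R)).
    by apply: ler_sum => v _; rewrite ler_wpM2r ?le_kap ?inE ?eqxx.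
  rewrite -mulr_sumr mulrC ler_wpM2r // -natr_sum ler_nat.
  rewrite -big_mkcond sum1_card /=; apply: leq_trans (card_size used) _.
  exact: leq_trans (leq_addr _ _) le_N.
have lt_v : layerE r b (upd m u v) F + (v \in used)%:R + (size r * N)%:R * kap < 1.
  apply: le_lt_trans lt1; rewrite mulSn natrD mulrDl addrA lerD2r.
  exact: le_v.
have v_used : v \notin used.
  apply/negP => vu; move: lt_v; rewrite vu; apply/negP; rewrite -leNgt.
  by rewrite -addrA addrCA lerDl addr_ge0 ?layerE_ge0 ?mulr_ge0.
rewrite (negPf v_used) addr0 in lt_v le_v.
have [||||||m' [eq_m' t_m' uniq_m' le_m']] := IH (upd m u v) (v :: used) => //=.
- by move=> u' v' u'r; rewrite le_kap // inE u'r orbT.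
- by move=> u' u'r; rewrite sum1 // inE u'r orbT.
- by rewrite addSnnS.
- by rewrite v_used.
have m'u : m' u = v by rewrite eq_m' // /upd eqxx.
exists m'; split.
- move=> w; rewrite inE negb_or => /andP[wu wr].
  by rewrite eq_m' // /upd (negPf wu).
- by move=> w; rewrite inE => /orP[/eqP ->|/t_m' //]; rewrite m'u.
- by move: uniq_m'; rewrite m'u -[v :: used]cat1s uniq_catCA.
- by apply: le_trans le_m' _; rewrite mulSn natrD mulrDl addrA lerD2r.
Qed.

Variables (delta kap : R).
Hypotheses (delta_gt0 : 0 < delta) (le_delta : forall x, delta <= degw x).
Hypotheses (kap_gt0 : 0 < kap) (z0_gt0 : 0 < z0).
Hypotheses (delta_kap : 1 <= delta * kap) (delta_z0 : 1 <= delta * z0 * kap).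

Lemma step1_le x y : step1 x y <= kap.
Proof.
rewrite /step1 ler_pdivrMr ?degw_gt0 // (le_trans (awt_le1 _ _)) //.
by rewrite (le_trans delta_kap) // mulrC ler_wpM2l // ltW.
Qed.

(** A midpoint has weight at most [1 / (delta * z0)], which [kap] dominates. *)
Lemma resample_le x y m : z0 <= codegw x y -> resample x y m <= kap.
Proof.
move=> z_le; have cg := lt_le_trans z0_gt0 z_le.
rewrite /resample ler_pdivrMr // ler_pdivrMr ?degw_gt0 //.
apply: (@le_trans _ _ 1).
  by rewrite mulr_ile1 ?awt_ge0 ?awt_le1.
apply: le_trans delta_z0 _.
rewrite mulrC -mulrA ler_wpM2l ?(ltW kap_gt0) // mulrC.
by apply: ler_pM => //; apply: ltW.
Qed.

(** A bad pair in the current layer would alone bring the potential to 1, so every [tstep] is a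
    genuine law bounded by [kap] and the greedy choice applies. The list [used] collects the layers
    already drawn; layer 0 never enters it, whence the shifted indices in the conclusion. *)
Lemma layers_greedy N j b (used : seq W) :
    uniq used -> (size used + j * size s <= N)%N ->
    potential j b + (j * (size s * N))%:R * kap < 1 ->
  exists X : nat -> U -> W, [/\ X 0%N = b,
    forall i u, (i < j)%N -> 0 < tstep (X i) u (X i.+1 u),
    forall i u, (i < j)%N -> X i.+1 u \notin used &
    forall i i' u u', (i < j)%N -> (i' < j)%N -> X i.+1 u = X i'.+1 u' ->
      i = i' /\ u = u'].
Proof.
elim: j b used => [|j IH] b used uniq_used le_N lt1.
  by exists (fun=> b); split.
rewrite potentialS mulSn natrD mulrDl addrA in lt1.
have jN0 k : 0 <= k%:R * kap by rewrite mulr_ge0 // ltW.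
have L0 : 0 <= layerE s b b (potential j).
  by apply/layerE_ge0 => m; apply: potential_ge0.
have good u : u != root -> z0 <= codegw (b (par u)) (b u).
  move=> u_root; rewrite leNgt; apply/negP => bad_u.
  move: lt1; apply/negP; rewrite -leNgt (bigD1 u) //= {1}/bad bad_u.
  rewrite -!addrA lerDl !addr_ge0 //; apply: sumr_ge0 => w _; exact: bad_ge0.
have le_kap u v : tstep b u v <= kap.
  by rewrite /tstep; case: eqVneq => [_|/good]; [apply: step1_le|apply: resample_le].
have sum1 u : \sum_v tstep b u v = 1.
  rewrite /tstep; case: eqVneq => [_|/good gu]; first exact: sum_step1.
  by rewrite sum_resample // gt_eqF // (lt_le_trans z0_gt0).
have B0 : 0 <= \sum_(u | u != root) bad u b.
  by apply: sumr_ge0 => u _; apply: bad_ge0.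
have [||m [_ t_m uniq_m le_m]] :=
    @layerE_greedy s b b (potential j) used kap N uniq_s (ltW kap_gt0)
      (fun u v _ => le_kap u v) (fun u _ => sum1 u) (potential_ge0 j) _ uniq_used.
- by apply: leq_trans le_N; rewrite mulSn leq_add2l leq_addr.
- apply: le_lt_trans lt1; rewrite -[leLHS]addr0; apply: lerD => //.
  by rewrite lerD2r lerDr.
have [||X [X0 stepX usedX injX]] := IH m (map m s ++ used) uniq_m.
- by rewrite size_cat size_map addnAC addnC -mulSn.
- apply: le_lt_trans lt1; rewrite lerD2r (le_trans le_m) //.
  by rewrite lerD2r lerDr.
have newX i u u' : (i < j)%N -> X 0%N u' = X i.+1 u -> False.
  move=> ij E; have := usedX i u ij.
  by rewrite -E X0 mem_cat map_f ?s_full.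
exists (fun i => if i is i'.+1 then X i' else b); split=> //.
- by move=> [|i] u ij; [rewrite X0; apply: t_m|apply: stepX].
- move=> [|i] u ij.
    rewrite X0; apply/negP => mu; move: uniq_m; rewrite cat_uniq.
    by case/and3P=> _ /hasPn/(_ _ mu); rewrite /= map_f ?s_full.
  by have := usedX i u ij; rewrite mem_cat negb_or => /andP[].
- move=> [|i] [|i'] u u' ij i'j.
  + rewrite X0 => E; split=> //; move: uniq_m; rewrite cat_uniq => /andP[um _].
    exact: (uniq_map_inj um) (s_full _) (s_full _) E.
  + by move/newX => /(_ i'j).
  + by move/esym/newX => /(_ ij).
  + by move/injX => /(_ ij i'j)[-> ->].
Qed.

(** * An initial layer of small potential *)

Variables (w0 : W) (dep : U -> nat) (D : nat).
Hypothesis chain_to : forall u, u != root -> exists l : seq U,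
  [/\ path parent_of root (rcons l u), subseq (root :: rcons l u) s,
      map dep (root :: rcons l u) = iota 0 (size l).+2 & (size l < D)%N].

(* The initial layer need not be injective: only its law along root-to-vertex
   paths matters, and the embedding starts at the next layer. *)
Definition depth_layer (y : seq W) : U -> W := fun u => nth w0 y (dep u).

(** By stationarity [par u] and [u] occupy consecutive places of a chain, whatever [j] is. The pair
    [(x, y)] then has weight [degw x * step2 x y = codegw x y], so each bad pair contributes at most
    [z0]. *)
Lemma chainE_layers_bad j u : u != root ->
  chainE D (fun y => layers j (bad u) (depth_layer y)) <= (#|W| ^ 2)%:R * z0.
Proof.
move=> u_root; have [l [pl sub_l dep_l le_D]] := chain_to u_root.
pose g1 (t : seq W) : R := (codegw (nth w0 t 0) (nth w0 t 1) < z0)%R%:R.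
(* The list [root :: rcons l u] has [size l + 2] entries, so dropping [size l] of them leaves
   [par u] and [u]. *)
pose g (t : seq W) := g1 (drop (size l) t).
have g0 t : 0 <= g t by apply: ler0n.
have le_g b : bad u b <= g (map b (root :: rcons l u)).
  rewrite /bad /g /g1 !nth_drop addn0 addn1.
  have -> : nth w0 (map b (root :: rcons l u)) (size l) = b (par u).
    rewrite (nth_map root) /= ?size_rcons ?ltnS // -rcons_cons nth_rcons /= ltnSn.
    move: pl; rewrite rcons_path => /andP[_ /andP[_ /eqP ->]].
    by rewrite -[size l]/((size (root :: l)).-1) nth_last.
  have -> : nth w0 (map b (root :: rcons l u)) (size l).+1 = b u.
    by rewrite /= (nth_map root) ?size_rcons // nth_rcons ltnn eqxx.
  by [].
apply: (@le_trans _ _ (chainE D (fun y => iter j sweep g (take (size l).+2 y)))).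
  apply: le_chainE => y sy.
  apply: le_trans (layers_le _ _ pl sub_l g0 le_g) _.
  rewrite /depth_layer (map_comp (nth w0 y) dep) dep_l map_nth_iota0 ?sy //.
rewrite (chainE_take (iter j sweep g)) // chainE_iter_sweep -addn1 chainE_drop.
rewrite /chainE /= (_ : (#|W| ^ 2)%:R * z0 = \sum_(x : W) \sum_(y : W) z0); last first.
  by rewrite !sumr_const -mulrnA mulnn mulr_natl.
apply: ler_sum => x _; rewrite mulr_sumr; apply: ler_sum => y _.
rewrite mulrA degw_step2 /g1 /=.
by case: ltrP => [/ltW|_]; rewrite ?mulr1 // mulr0 ltW.
Qed.

(** Averaging over the initial chain: the total mass is at least [#|W| * delta], while the integral
    of the potential is at most [L * #|U| * #|W| ^ 2 * z0]. *)
Lemma exists_potential_lt L (theta : R) :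
    (L * #|U| * #|W|)%:R * z0 < delta * theta ->
  exists b, potential L b < theta.
Proof.
move=> lt_theta.
have [/existsP[y lt_y]|/existsPn no] :=
  boolP [exists y : D.+1.-tuple W, potential L (depth_layer y) < theta].
  by exists (depth_layer y).
have W_gt0 : (0 < #|W|)%N by apply/card_gt0P; exists w0.
have th0 : 0 <= theta.
  by rewrite -(pmulr_rge0 _ delta_gt0) (le_trans _ (ltW lt_theta)) // mulr_ge0 // ltW.
have : chainE D (fun=> theta) <= (L * #|U|)%:R * ((#|W| ^ 2)%:R * z0).
  apply: (@le_trans _ _ (chainE D (fun y => potential L (depth_layer y)))).
    apply: le_chainE => y /eqP sy.
    by have := no (Tuple sy); rewrite -leNgt.
  rewrite chainE_sum; under eq_bigr do rewrite chainE_sum.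
  rewrite natrM -mulrA mulr_natl -[X in _ *+ X]card_ord -sumr_const.
  apply: ler_sum => i _.
  apply: (@le_trans _ _ (\sum_(u | u != root) (#|W| ^ 2)%:R * z0)).
    by apply: ler_sum => u; apply: chainE_layers_bad.
  rewrite sumr_const -[leLHS]mulr_natl ler_wpM2r ?mulr_ge0 ?(ltW z0_gt0) //.
  by rewrite ler_nat max_card.
rewrite chainE_cst => /le_lt_trans; move=> le_c.
have : (#|W|%:R * delta) * theta <= (\sum_x degw x) * theta.
  by rewrite ler_wpM2r // mulr_natl -sumr_const; apply: ler_sum => x _.
have /le_c : (L * #|U|)%:R * ((#|W| ^ 2)%:R * z0) < #|W|%:R * delta * theta.
  rewrite -mulrA mulrA -natrM -mulnn mulnA mulnC natrM -mulrA ltr_pM2l //.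
  by rewrite ltr0n.
by move=> /lt_le_trans h /h; rewrite ltxx.
Qed.

End Layers.
End RandomWalk.

(** * Layers in a graph of large minimum degree *)

Lemma tstep_adj (R : realFieldType) (W : finType) (e : rel W) (U : finType)
    (root : U) (par : U -> U) (b : U -> W) u m : symmetric e ->
    0 < tstep R e root par b u m ->
  e (b u) m /\ (u != root -> e (b (par u)) m).
Proof.
move=> sym_e; rewrite /tstep; case: eqVneq => [->|_].
  by rewrite /step1 /awt; case: (e _ _) => //; rewrite mul0r ltxx.
rewrite /resample /awt sym_e.
case: (e _ _); rewrite ?mul0r ?ltxx //.
by rewrite sym_e; case: (e _ _); rewrite ?mulr0 ?mul0r ?ltxx.
Qed.

(** Depth separates the entries of [l], so [l] must be the sorted enumeration filtered to its
    members. Applied to paths from the root, it makes them subsequences of the drawing order. *)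
Lemma subseq_strict_sort (U : finType) (dep : U -> nat) (l : seq U) :
  sorted ltn (map dep l) ->
  subseq l (sort (fun x y => (dep x <= dep y)%N) (enum U)).
Proof.
move=> lt_l; set leT := fun x y => (dep x <= dep y)%N.
have leT_total : total leT by move=> x y; apply: leq_total.
have leT_trans : transitive leT by move=> y x z; apply: leq_trans.
have uniq_dl : uniq (map dep l).
  by apply: sorted_uniq lt_l; [apply: ltn_trans|apply: ltnn].
have uniq_l := map_uniq uniq_dl.
suff -> : l = [seq x <- sort leT (enum U) | x \in l] by apply: filter_subseq.
apply: (sorted_eq_in (leT := leT)).
- by move=> x y z _ _ _; apply: leT_trans.
- move=> x y xl yl; rewrite -eqn_leq => /eqP; exact: (uniq_map_inj uniq_dl).
- by move: lt_l; rewrite sorted_map; apply: sub_sorted => x y; apply: ltnW.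
- by apply: sorted_filter => //; apply: sort_sorted.
- apply: uniq_perm; rewrite ?filter_uniq ?sort_uniq ?enum_uniq // => x.
  by rewrite mem_filter mem_sort mem_enum andbT.
Qed.

Definition rooted (U : finType) (root : U) (par : U -> U) (dep : U -> nat) :=
  dep root = 0%N /\ forall u, u != root -> dep u = (dep (par u)).+1.

Lemma rooted_chain (U : finType) (root : U) par (dep : U -> nat) u :
    rooted root par dep -> u != root ->
  exists l : seq U, [/\ path (parent_of root par) root (rcons l u),
    map dep (root :: rcons l u) = iota 0 (size l).+2 & dep u = (size l).+1].
Proof.
move=> [dep_root dep_par]; move E: (dep u) => n.
elim: n u E => [|n IH] u E u_root; first by rewrite dep_par in E.
have [p_root|p_root] := eqVneq (par u) root.
  exists [::]; split=> /=; rewrite ?dep_root ?E //.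
  - by rewrite /parent_of u_root p_root eqxx.
  - by move: E; rewrite dep_par // p_root dep_root => -[<-].
  - by move: E; rewrite dep_par // p_root dep_root => -[<-].
have [|l [pl dep_l size_l]] := IH (par u) _ p_root.
  by move: E; rewrite dep_par // => -[].
exists (rcons l (par u)); split.
- by rewrite rcons_path pl last_rcons /parent_of u_root eqxx.
- rewrite -rcons_cons map_rcons dep_l size_rcons -[in RHS]addn1 iotaD cats1.
  by congr rcons; rewrite E size_l.
- by rewrite size_rcons size_l.
Qed.

(** The unit budget is split in two: less than 1/2 for the potential of the initial layer and 1/2
    for collisions. *)
Lemma exists_layers (W U : finType) (e : rel W) (root : U) (par : U -> U)
    (dep : U -> nat) (L d : nat) (w0 : W) :
    symmetric e -> rooted root par dep -> (0 < L)%N ->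
    (forall x, d <= #|[pred y | e x y]|)%N ->
    (2 * (L * #|U|) ^ 2 <= d)%N ->
    (4 * (L * #|U|) ^ 3 * #|W| < d ^ 2)%N ->
  exists X : nat -> U -> W, [/\
    forall i u, (i < L)%N -> e (X i u) (X i.+1 u),
    forall i u, (i < L)%N -> u != root -> e (X i (par u)) (X i.+1 u) &
    forall i i' u u', (i < L)%N -> (i' < L)%N -> X i.+1 u = X i'.+1 u' ->
      i = i' /\ u = u'].
Proof.
move=> sym_e rooted_U L_gt0 deg_e le_d lt_d.
have U_gt0 : (0 < #|U|)%N by apply/card_gt0P; exists root.
set N := (L * #|U|)%N in le_d lt_d.
have N_gt0 : (0 < N)%N by rewrite muln_gt0 L_gt0.
have d_gt0 : (0 < d)%N by apply: leq_trans le_d; rewrite muln_gt0 expn_gt0 N_gt0.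
have nbr x : exists y, e x y.
  by have /card_gt0P[y] := leq_trans d_gt0 (deg_e x); rewrite inE; exists y.
pose s := sort (fun x y => (dep x <= dep y)%N) (enum U).
have size_s : size s = #|U| by rewrite size_sort -cardE.
have uniq_s : uniq s by rewrite sort_uniq enum_uniq.
have s_full u : u \in s by rewrite mem_sort mem_enum.
pose D := (\max_u dep u)%N.
have NR : 0 < (N%:R : rat) by rewrite ltr0n.
have dR : 0 < (d%:R : rat) by rewrite ltr0n.
(* Chosen so that the collision cost [N * N * kap] is 1/2. *)
pose kap : rat := (2 * N%:R ^+ 2)^-1.
have kap_gt0 : 0 < kap by rewrite invr_gt0 mulr_gt0 ?exprn_gt0.
(* Chosen so that [d * z0 * kap = 1]; the averaging condition with [theta = 1 / 2] then reads
   [4 * N ^ 3 * #|W| < d ^ 2]. *)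
pose z0 : rat := 2 * N%:R ^+ 2 / d%:R.
have z0_gt0 : 0 < z0 by rewrite divr_gt0 // mulr_gt0 ?exprn_gt0.
have le_deg x : (d%:R : rat) <= degw rat e x.
  rewrite /degw /awt -natr_sum ler_nat.
  by rewrite -big_mkcond sum1_card; apply: deg_e.
have chain_to u : u != root -> exists l : seq U,
  [/\ path (parent_of root par) root (rcons l u), subseq (root :: rcons l u) s,
      map dep (root :: rcons l u) = iota 0 (size l).+2 & (size l < D)%N].
  move=> u_root; have [l [pl dep_l size_l]] := rooted_chain rooted_U u_root.
  exists l; split=> //; last by rewrite -size_l /D (leq_bigmax u).
  by apply: subseq_strict_sort; rewrite dep_l iota_ltn_sorted.
have d_kap : 1 <= d%:R * kap.
  rewrite /kap ler_pdivlMr ?mulr_gt0 ?exprn_gt0 // mul1r -natrX -natrM ler_nat //.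
have d_z0 : 1 <= d%:R * z0 * kap.
  rewrite /z0 /kap; have -> : d%:R * (2 * N%:R ^+ 2 / d%:R) / (2 * N%:R ^+ 2) = 1 :> rat.
    by field; rewrite !gt_eqF.
  by [].
have [|b lt_b] := @exists_potential_lt rat W e sym_e nbr U root par s uniq_s z0 d%:R
    dR le_deg z0_gt0 w0 dep D chain_to L (1 / 2).
  rewrite /z0 -/N.
  rewrite -subr_gt0.
  have -> : d%:R * (1 / 2) - (N * #|W|)%:R * (2 * N%:R ^+ 2 / d%:R) =
     (d ^ 2)%:R / (2 * d%:R) - (4 * N ^ 3 * #|W|)%:R / (2 * d%:R) :> rat.
    by rewrite !(natrX, natrM); field; rewrite gt_eqF.
  by rewrite subr_gt0 ltr_pM2r ?invr_gt0 ?mulr_gt0 // ltr_nat.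
have [||| X [_ stepX _ injX]] := @layers_greedy rat W e nbr U root par s uniq_s
    s_full z0 d%:R kap dR le_deg kap_gt0 z0_gt0 d_kap d_z0 N L b [::].
- by [].
- by rewrite add0n size_s.
- rewrite size_s mulnA -/N.
  have -> : (N * N)%:R * kap = 1 / 2 by rewrite natrM /kap; field; rewrite gt_eqF.
  lra.
exists X; split=> // i u iL.
  by have [] := tstep_adj sym_e (stepX i u iL).
by have [_] := tstep_adj sym_e (stepX i u iL).
Qed.

(** * Rooting a tree *)

(** The depth is the distance from the root, and the parent is a predecessor one step closer, found
    on a shortest path. *)
Lemma connect_dist (U : finType) (r : rel U) (root : U) :
  (forall u, connect r root u) ->
  exists (par : U -> U) (dep : U -> nat), rooted root par dep /\
    forall u, u != root -> r (par u) u.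
Proof.
move=> conn.
pose reach u n := [exists p : n.-tuple U, path r root p && (last root p == u)].
have ex_reach u : exists n, reach u n.
  have /connectP[p rp ->] := conn u; exists (size p).
  by apply/existsP; exists (in_tuple p); rewrite rp eqxx.
pose dep u := ex_minn (ex_reach u).
have dep_le p : path r root p -> (dep (last root p) <= size p)%N.
  move=> rp; rewrite /dep; case: ex_minnP => n _; apply.
  by apply/existsP; exists (in_tuple p); rewrite rp eqxx.
have depP u : exists p, [/\ path r root p, last root p = u & size p = dep u].
  rewrite /dep; case: ex_minnP => n /existsP[p /andP[rp /eqP lp]] _.
  by exists p; rewrite size_tuple.
pose par u := odflt root [pick w | r w u && (dep u == (dep w).+1)].
have parP u : u != root -> r (par u) u && (dep u == (dep (par u)).+1).
  move=> u_root; rewrite /par; case: pickP => [//|no].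
  have [p [+ + size_p]] := depP u.
  case/lastP: p size_p => [|q v]; first by move=> _ _ /= E; rewrite E eqxx in u_root.
  rewrite size_rcons rcons_path last_rcons => size_q /andP[rq rv] vu; subst v.
  have := no (last root q); rewrite rv /= eqn_leq -size_q !ltnS dep_le // andbT.
  have [p [rp lp size_p]] := depP (last root q).
  have := dep_le (rcons p u); rewrite last_rcons size_rcons rcons_path rp lp rv.
  by rewrite size_p -size_q ltnS => /(_ isT) ->.
exists par, dep; split; last by move=> u /parP/andP[].
split; first by apply/eqP; rewrite -leqn0 (dep_le [::]).
by move=> u /parP/andP[_ /eqP].
Qed.

(* An edge outside a spanning tree closes a cycle with the tree path joining
   its ends. *)
Lemma tree_rooted (U : finType) (T : sgraph U) : is_tree T ->
  exists (root : U) (par : U -> U) (dep : U -> nat), rooted root par dep /\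
    forall x y, adj T x y -> parent_of root par x y || parent_of root par y x.
Proof.
move=> [[/card_gt0P[root _] conn] acyc].
have [par [dep [rooted_U adj_par]]] := connect_dist (conn root).
exists root, par, dep; split=> // x y adj_xy.
pose r' x y := parent_of root par x y || parent_of root par y x.
have sub_r' : subrel r' (adj T).
  by move=> a b /orP[] /andP[/adj_par + /eqP pE]; rewrite pE // adj_sym.
have sym_r' : symmetric r' by move=> a b; rewrite /r' orbC.
have conn_root u : connect r' root u.
  move E: (dep u) => n; elim: n u E => [|n IH] u E.
    by have [->|/(rooted_U.2)] := eqVneq u root; rewrite ?connect0 // E.
  have [->|u_root] := eqVneq u root; first exact: connect0.
  have /IH : dep (par u) = n by move: E; rewrite rooted_U.2 // => -[].
  move=> /connect_trans; apply; apply: connect1.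
  by rewrite /r' /parent_of u_root eqxx.
have : connect r' x y.
  apply: connect_trans (conn_root y).
  by rewrite (sym_connect_sym sym_r').
case/connectP => p0 rp0 y_def.
case/shortenP: rp0 y_def => p rp uniq_p _ y_def.
have := acyc (x :: p); rewrite /ucycle uniq_p andbT /= rcons_path -y_def.
rewrite (sub_path sub_r' rp) adj_sym adj_xy => /(_ isT).
(* Acyclicity leaves a path of at most one edge, and that edge must be the parent edge joining [x]
   and [y]. *)
case: p rp uniq_p y_def => [|z [|z' p]] //=.
  by move=> _ _ yx; rewrite yx adj_irrefl in adj_xy.
by rewrite andbT => + _ -> _.
Qed.

(** * The upper bound *)

(** Take [A] minimal among the sets spanning more than [d * #|A|] edges. Deleting a vertex with
    fewer than [d] neighbours in [A] would preserve this inequality. *)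
Lemma exists_min_degree (V : finType) (G : sgraph V) (d : nat) :
    (d * #|V| < #|edges G|)%N ->
  exists A : {set V}, A != set0 /\
    forall x, x \in A -> (d <= #|[set y in A | adj G x y]|)%N.
Proof.
move=> lt_d; pose E (A : {set V}) := [set a in edges G | a \subset A].
have PT : (d * #|[set: V]| < #|E [set: V]|)%N.
  rewrite cardsT (leq_trans lt_d) //; apply: subset_leq_card.
  by apply/subsetP => a aG; rewrite inE aG subsetT.
have [A minA _] := minset_exists (P := fun A => (d * #|A| < #|E A|)%N) PT.
have /minsetP[PA min_A] := minA.
exists A; split.
  apply: contraTneq PA => ->; rewrite cards0 muln0 -leqNgt leqn0 cards_eq0.
  apply/eqP/setP => a; rewrite !inE subset0; apply/negP => /andP[aG /eqP a0].
  by have := forall_inP (edges_card2 G) a aG; rewrite a0 cards0.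
move=> x xA; rewrite leqNgt; apply/negP => lt_x.
have cA : #|A| = (#|A :\ x|).+1 by rewrite (cardsD1 x) xA.
have : (d * #|A :\ x| < #|E (A :\ x)|)%N.
  have : (#|E A| <= #|E (A :\ x)| + #|[set y in A | adj G x y]|)%N.
    set B := [set y in A | adj G x y].
    apply: leq_trans (leq_add (leqnn _) (leq_imset_card (fun y => [set x; y]) (mem B))).
    apply: leq_trans (leq_card_setU _ _).1; apply/subset_leq_card/subsetP => a.
    rewrite !inE => /andP[aG aA]; rewrite aG subsetD1 aA /=.
    have [xa|//] := boolP (x \in a); apply/imsetP.
    have /cards2P[y [z [yz aE]]] := forall_inP (edges_card2 G) a aG.
    wlog: y z yz aE / x = y => [th|xy].
      move: (xa); rewrite {1}aE !inE => /orP[] /eqP E1; first exact: (th y z).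
      by apply: (th z y) => //; rewrite 1?eq_sym // aE setUC.
    exists z; rewrite ?xy // inE /adj xy -aE aG andbT.
    by rewrite (subsetP aA) // aE set22.
  rewrite cA in PA; lia.
move=> P'; have := min_A _ P' (subD1set A x) => AE.
by have := setD11 x A; rewrite AE xA.
Qed.

Lemma contains_layers (n : nat) (G : sgraph 'I_n) (A : {set 'I_n})
    (U V : finType) (T : sgraph U) (P : sgraph V) (root : U) par dep
    (k D : nat) (pos : V -> nat) (X : nat -> U -> {x | x \in A}) :
    rooted root par dep ->
    (forall x y, adj T x y -> parent_of root par x y || parent_of root par y x) ->
    (forall u, dep u <= D)%N -> (forall v, pos v < k)%N -> injective pos ->
    (forall v w, adj P v w -> (pos v).+1 = pos w \/ (pos w).+1 = pos v) ->
    (forall i u, (i < k + D)%N -> adj G (val (X i u)) (val (X i.+1 u))) ->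
    (forall i u, (i < k + D)%N -> u != root ->
      adj G (val (X i (par u))) (val (X i.+1 u))) ->
    (forall i i' u u', (i < k + D)%N -> (i' < k + D)%N ->
      X i.+1 u = X i'.+1 u' -> i = i' /\ u = u') ->
  contains G (cart_prod T P).
Proof.
move=> [_ dep_par] adjT le_D lt_k pos_inj adjP stepX parX injX.
have lt_L u v : (pos v + dep u < k + D)%N.
  by apply: leq_trans (leq_add (lt_k v) (le_D u)); rewrite addSn.
(* The successor skips layer 0, whose entries may coincide. Path edges and tree edges both change
   the layer index by exactly one. *)
apply/containsP; exists (fun p => val (X (pos p.2 + dep p.1).+1 p.1)).
  move=> [u v] [u' v'] /= /val_inj /(injX _ _ _ _ (lt_L u v) (lt_L u' v')).
  by case=> + uu'; subst u' => /addIn /pos_inj ->.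
have vert u v v' : (pos v).+1 = pos v' ->
    adj G (val (X (pos v + dep u).+1 u)) (val (X (pos v' + dep u).+1 u)).
  by move=> E; rewrite -E addSn; apply: stepX; rewrite -addSn E lt_L.
have horiz u u' v : parent_of root par u u' ->
    adj G (val (X (pos v + dep u).+1 u)) (val (X (pos v + dep u').+1 u')).
  move=> /andP[u'_root /eqP <-]; rewrite (dep_par u') // addnS.
  by apply: parX => //; rewrite -addnS -dep_par.
move=> [u v] [u' v']; rewrite adj_cart_prod /=.
case/orP=> /andP[].
  by move=> /eqP <- /adjP[] E; [|rewrite adj_sym]; apply: vert.
by move=> /adjT/orP[] E /eqP <-; [|rewrite adj_sym]; apply: horiz.
Qed.

Lemma ex_tree_path_le (U V : finType) (T : sgraph U) (P : sgraph V) :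
    is_tree T -> is_path P ->
  exists2 K : nat, (0 < K)%N & forall n s : nat, (0 < n)%N -> (n <= s ^ 2)%N ->
    (ex n (cart_prod T P) <= K * s * n)%N.
Proof.
move=> treeT [k k_gt0 [f [g fK gK] adj_f]].
have [root [par [dep [rooted_U adjT]]]] := tree_rooted treeT.
pose D := (\max_u dep u)%N; set L := (k + D)%N; pose N := (L * #|U|)%N.
have N_gt0 : (0 < N)%N.
  by rewrite muln_gt0 addn_gt0 k_gt0; apply/card_gt0P; exists root.
(* With [d = 4 * N ^ 2 * s] and [#|W| <= n <= s ^ 2], the square [d ^ 2 = 16 * N ^ 4 * s ^ 2]
   exceeds [4 * N ^ 3 * #|W|]. *)
exists (4 * N ^ 2)%N; first by rewrite muln_gt0 expn_gt0 N_gt0.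
move=> n s n_gt0 le_ns.
have s_gt0 : (0 < s)%N by have := leq_trans n_gt0 le_ns; rewrite expn_gt0 orbF.
apply/bigmax_leqP => G; apply: contraR; rewrite -ltnNge.
set d := (4 * N ^ 2 * s)%N => lt_d.
have [|A [A_neq0 deg_A]] := @exists_min_degree _ G d; first by rewrite card_ord.
have /set0Pn[w0 w0A] := A_neq0.
pose W : finType := {x | x \in A}.
pose e : rel W := fun x y => adj G (val x) (val y).
have cardW : (#|W| <= n)%N by rewrite card_sig -[leqRHS]card_ord max_card.
have deg_W (x : W) : (d <= #|[pred y | e x y]|)%N.
  apply: leq_trans (deg_A _ (valP x)) _.
  rewrite -(card_image val_inj); apply: subset_leq_card; apply/subsetP => y.
  rewrite inE => /andP[yA xy]; apply/imageP; exists (exist _ y yA) => //.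
have [||||X [stepX parX injX]] :=
    @exists_layers W U e root par dep L d (exist _ w0 w0A) _ rooted_U _ deg_W.
- by move=> x y; apply: adj_sym.
- by rewrite addn_gt0 k_gt0.
- rewrite -/N /d; nia.
- rewrite -/N /d.
  apply: (@leq_ltn_trans (4 * N ^ 3 * s ^ 2)).
    by rewrite leq_mul2l (leq_trans cardW le_ns) orbT.
  have -> : ((4 * N ^ 2 * s) ^ 2 = 16 * N * N ^ 3 * s ^ 2)%N by ring.
  rewrite ltn_pmul2r ?expn_gt0 ?s_gt0 //.
  have := expn_gt0 N 3; rewrite N_gt0 /=; nia.
apply: (@contains_layers n G A U V T P root par dep k D (fun v => g v) X) => //.
- by move=> u; apply: leq_bigmax.
- by move=> v w /val_inj /(can_inj gK).
- move=> v w; rewrite -[v]gK -[w]gK adj_f adj_graph_of_rel !fK.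
  by case/andP=> _ /orP[] /eqP; [left|right].
Qed.

(** * The lower bound *)

Definition C4_free (V : finType) (G : sgraph V) : Prop :=
  forall x y z w, adj G x y -> adj G y z -> adj G z w -> adj G w x ->
    x = z \/ y = w.

Lemma edges_adj (V : finType) (G : sgraph V) : (0 < #|edges G|)%N ->
  exists x y, adj G x y.
Proof.
move=> /card_gt0P[a aG].
have /cards2P[x [y [_ aE]]] := forall_inP (edges_card2 G) a aG.
by exists x, y; rewrite /adj -aE.
Qed.

Lemma adj_neq (V : finType) (G : sgraph V) x y : adj G x y -> x != y.
Proof. by apply: contraTneq => ->; rewrite adj_irrefl. Qed.

Lemma C4_free_cart_prod (V' U V : finType) (G : sgraph V') (T : sgraph U)
    (P : sgraph V) : (0 < #|edges T|)%N -> (0 < #|edges P|)%N ->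
  C4_free G -> ~~ contains G (cart_prod T P).
Proof.
move=> /edges_adj[u [u' uu']] /edges_adj[v [v' vv']] free.
apply/containsP => -[f f_inj f_adj].
have [] := free (f (u, v)) (f (u', v)) (f (u', v')) (f (u, v')).
- by apply: f_adj; rewrite adj_cart_prod /= uu' eqxx orbT.
- by apply: f_adj; rewrite adj_cart_prod /= vv' eqxx.
- by apply: f_adj; rewrite adj_cart_prod /= adj_sym uu' eqxx orbT.
- by apply: f_adj; rewrite adj_cart_prod /= adj_sym vv' eqxx.
- by move=> /f_inj[uE _]; move: (adj_neq uu'); rewrite uE eqxx.
- by move=> /f_inj[uE _]; move: (adj_neq uu'); rewrite uE eqxx.
Qed.

Lemma ex_ge (n : nat) (U : finType) (H : sgraph U) (G : sgraph 'I_n) :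
  ~~ contains G H -> (#|edges G| <= ex n H)%N.
Proof. by move=> GH; apply: leq_bigmax_cond. Qed.

(** Only the lines [y = a * x + b] are used, stored as [(a, b)]. An incidence is determined by [x],
    [a] and [b], which are free. The vertices beyond the points and lines stay isolated. *)
Lemma point_line_graph (F : finFieldType) (n : nat) : (2 * #|F| ^ 2 <= n)%N ->
  exists2 G : sgraph 'I_n, C4_free G & (#|F| ^ 3 <= #|edges G|)%N.
Proof.
move=> le_n; pose S : finType := (F * F + F * F)%type.
have le_S : (#|S| <= n)%N.
  by rewrite card_sum card_prod mulnn addnn -mul2n.
pose i (x : S) : 'I_n := widen_ord le_S (enum_rank x).
have i_inj : injective i by move=> x y /(congr1 val) /= /val_inj /enum_rank_inj.
pose inc (p l : F * F) := p.2 == l.1 * p.1 + l.2.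
have inc_uniq p p' l l' : inc p l -> inc p l' -> inc p' l -> inc p' l' ->
    p = p' \/ l = l'.
  case: p p' l l' => [x y] [x' y'] [a b] [a' b']; rewrite /inc /=.
  move=> /eqP -> /eqP E1 /eqP -> /eqP E2.
  (* The alternating sum of the four incidence equations. *)
  have : (a - a') * (x - x') = 0.
    transitivity ((a * x + b) - (a' * x + b') - ((a * x' + b) - (a' * x' + b'))).
      by ring.
    by rewrite E1 E2 !subrr.
  move/eqP; rewrite mulf_eq0 !subr_eq0 => /orP[] /eqP E3; subst; [right|left] => //.
  by move/addrI: E1 => ->.
pose r (x y : 'I_n) :=
  [exists p, exists l, [&& x == i (inl p), y == i (inr l) & inc p l]].
exists (graph_of_rel r).
  have adj_pt p y : adj (graph_of_rel r) (i (inl p)) y ->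
      exists2 l, y = i (inr l) & inc p l.
    rewrite adj_graph_of_rel => /andP[_ /orP[] /existsP[p' /existsP[l]]].
      by case/and3P=> /eqP/i_inj[->] /eqP -> pl; exists l.
    by case/and3P=> _ /eqP/i_inj.
  have adj_ln l y : adj (graph_of_rel r) (i (inr l)) y ->
      exists2 p, y = i (inl p) & inc p l.
    rewrite adj_graph_of_rel => /andP[_ /orP[] /existsP[p /existsP[l']]].
      by case/and3P=> /eqP/i_inj.
    by case/and3P=> /eqP -> /eqP/i_inj[->] pl; exists p.
  have adj_dom x y : adj (graph_of_rel r) x y ->
      (exists p, x = i (inl p)) \/ (exists l, x = i (inr l)).
    rewrite adj_graph_of_rel => /andP[_ /orP[] /existsP[p /existsP[l]]].
      by case/and3P=> /eqP -> _ _; left; exists p.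
    by case/and3P=> _ /eqP -> _; right; exists l.
  move=> x y z w xy; have [[p xE]|[l xE]] := adj_dom _ _ xy; subst x.
    have [l -> pl] := adj_pt _ _ xy => /adj_ln[p' -> p'l] /adj_pt[l' -> p'l'].
    rewrite adj_sym => /adj_pt[l2 /i_inj[<-] pl'].
    by have [->|->] := inc_uniq _ _ _ _ pl pl' p'l p'l'; [left|right].
  have [p -> pl] := adj_ln _ _ xy => /adj_pt[l' -> pl'] /adj_ln[p' -> p'l'].
  rewrite adj_sym => /adj_ln[p2 /i_inj[<-] p'l].
  by have [->|->] := inc_uniq _ _ _ _ pl pl' p'l p'l'; [right|left].
pose E (t : F * F * F) : {set 'I_n} :=
  [set i (inl (t.1.1, t.1.2 * t.1.1 + t.2)); i (inr (t.1.2, t.2))].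
have E_inj : injective E.
  move=> [[x a] b] [[x' a'] b']; rewrite /E /= => EE.
  have : i (inl (x, a * x + b)) \in [set i (inl (x', a' * x' + b')); i (inr (a', b'))].
    by rewrite -EE set21.
  rewrite !inE !(inj_eq i_inj) orbF => /eqP[-> _].
  have : i (inr (a, b)) \in [set i (inl (x', a' * x' + b')); i (inr (a', b'))].
    by rewrite -EE set22.
  by rewrite !inE !(inj_eq i_inj) /= => /eqP[-> ->].
have -> : (#|F| ^ 3)%N = #|E @: [set: F * F * F]|.
  by rewrite card_imset // cardsT !card_prod !expnS muln1 mulnA.
apply/subset_leq_card/subsetP => _ /imsetP[[[x a] b] _ ->].
rewrite -/(adj _ _ _) adj_graph_of_rel /= (inj_eq i_inj) /=; apply/orP; left.
apply/existsP; exists (x, a * x + b); apply/existsP; exists (a, b).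
by rewrite !eqxx /inc /=.
Qed.

(** Replaces the point-line graph for small [n], where [k = 0] and no field has [2 ^ k] elements. *)
Lemma edge_graph (n : nat) : (1 < n)%N ->
  exists2 G : sgraph 'I_n, C4_free G & (0 < #|edges G|)%N.
Proof.
case: n => [|[|n]] // _.
pose r (x y : 'I_n.+2) := (x == ord0) && (y == ord_max).
exists (graph_of_rel r).
  have adjP x y : adj (graph_of_rel r) x y ->
      y = if x == ord0 then ord_max else ord0.
    by rewrite adj_graph_of_rel => /andP[_ /orP[] /andP[/eqP -> /eqP ->]].
  move=> x y z w /adjP -> _ _; rewrite adj_sym => /adjP ->.
  by right.
apply/card_gt0P; exists [set ord0; ord_max].
by rewrite -/(adj _ _ _) adj_graph_of_rel /r !eqxx.
Qed.

Lemma ex_tree_path_ge (U V : finType) (T : sgraph U) (P : sgraph V) n :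
    (0 < #|edges T|)%N -> (0 < #|edges P|)%N -> (1 < n)%N ->
  exists2 q : nat, (n <= 8 * q ^ 2)%N & (q ^ 3 <= ex n (cart_prod T P))%N.
Proof.
move=> edgeT edgeP n_gt1.
have n2_gt0 : (0 < n./2)%N by rewrite half_gt0.
(* The largest [k] with [4 ^ k <= n./2] makes points and lines fit, and [n./2 < 4 * 4 ^ k] gives the
   factor 8. *)
have /andP[] := @trunc_log_bounds 4 n./2 isT n2_gt0.
set k := trunc_log 4 _ => le_k lt_k.
have E4 : ((2 ^ k) ^ 2 = 4 ^ k)%N by rewrite expnAC.
exists (2 ^ k)%N; first by rewrite E4; move: lt_k; rewrite expnS; lia.
have [k0|k_gt0] := posnP k.
  have [G freeG G_gt0] := edge_graph n_gt1.
  by rewrite k0 (leq_trans G_gt0) // ex_ge // C4_free_cart_prod.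
have [F _ cardF] := PrimePowerField (isT : prime 2) k_gt0.
have [|G freeG] := @point_line_graph F n; first by rewrite cardF E4; lia.
by rewrite cardF => /leq_trans; apply; rewrite ex_ge // C4_free_cart_prod.
Qed.

(** * Square roots and the final constants *)

(** For the least such [s], either [s <= 1] or [(s - 1) ^ 2 < n] with [s <= 2 * (s - 1)]. *)
Lemma exists_sqrt_bounds (n : nat) : (0 < n)%N ->
  exists s : nat, (n <= s ^ 2)%N /\ (s ^ 2 <= 4 * n)%N.
Proof.
move=> n_gt0; have exs : exists s, (n <= s ^ 2)%N by exists n; nia.
exists (ex_minn exs); case: ex_minnP => s le_s min_s; split=> //.
have [|] := leqP s 1; first by nia.
case: s le_s min_s => // s le_s min_s s_gt0.
have : ~~ (n <= s ^ 2)%N by apply/negP => /min_s; rewrite ltnn.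
nia.
Qed.

Lemma powR_3half (R : realType) (x : R) : 0 < x -> x `^ (3 / 2) = x * Num.sqrt x.
Proof.
move=> x_gt0; have -> : 3 / 2 = 1 + 2^-1 :> R by field.
rewrite powRD; last by rewrite (gt_eqF x_gt0) implybT.
by rewrite powRr1 ?powR12_sqrt // ltW.
Qed.

Lemma sqrt_le (R : realType) (x y : R) : 0 <= y -> x <= y ^+ 2 -> Num.sqrt x <= y.
Proof.
by move=> y_ge0 xy; rewrite -[leRHS]ger0_norm // -sqrtr_sqr ler_wsqrtr.
Qed.

(** The lower bound is asserted from [n = 2] on, since a graph on one vertex has no edge and the
    extremal number is then 0. *)
Theorem theorem1p2 (R : realType) (U V : finType)
    (T : sgraph U) (P : sgraph V)
    (treeT : is_tree T) (pathP : is_path P)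
    (edgeT : (0 < #|edges T|)%N) (edgeP : (0 < #|edges P|)%N) :
  exists c C : R, [/\ 0 < c, 0 < C &
    forall n : nat, (0 < n)%N ->
      ((1 < n)%N -> c * n%:R `^ (3 / 2) <= (ex n (cart_prod T P))%:R) /\
      (ex n (cart_prod T P))%:R <= C * n%:R `^ (3 / 2)].
Proof.
have [K K_gt0 ex_le] := ex_tree_path_le treeT pathP.
(* From [n <= 8 * q ^ 2] follows [r <= 3 * q], so [n * r <= 24 * q ^ 3]; from [s ^ 2 <= 4 * n]
   follows [s <= 2 * r]. *)
exists (1 / 24), (2 * K%:R); split; rewrite ?divr_gt0 ?mulr_gt0 ?ltr0n //.
move=> n n_gt0; have n_gt0' : 0 < n%:R :> R by rewrite ltr0n.
rewrite powR_3half //; set r := Num.sqrt _.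
have r_ge0 : 0 <= r by apply: sqrtr_ge0.
have rr : r ^+ 2 = n%:R by rewrite sqr_sqrtr // ltW.
split=> [n_gt1|].
  have [q le_q q_le] := ex_tree_path_ge edgeT edgeP n_gt1.
  have q_ge0 : 0 <= q%:R :> R by [].
  have nq : n%:R <= 8 * q%:R ^+ 2 :> R by rewrite -natrX -natrM ler_nat.
  have rq : r <= 3 * q%:R by apply: sqrt_le; [rewrite mulr_ge0|nra].
  apply: (@le_trans _ _ (q ^ 3)%:R); last by rewrite ler_nat.
  have : n%:R * r <= (8 * q%:R ^+ 2) * (3 * q%:R) by apply: ler_pM => //; apply: ltW.
  rewrite natrX (_ : 8 * _ * _ = 24 * q%:R ^+ 3); last by ring.
  lra.
have [s [le_s s_le]] := exists_sqrt_bounds n_gt0.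
have := ex_le n s n_gt0 le_s; rewrite -(ler_nat R) => /le_trans; apply.
have s_r : s%:R <= 2 * r.
  rewrite -ler_sqr ?nnegrE ?mulr_ge0 // exprMn rr -!natrX -natrM ler_nat //.
rewrite !natrM [leRHS](_ : _ = K%:R * (2 * r) * n%:R); last by ring.
by rewrite ler_pM2r // ler_pM2l ?ltr0n.
Qed.
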